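(* Let $D_{2n}$ denote the dihedral group of order $2n$. Then the transiso graph $\Gamma_d(D_{2n})$ is complete for each divisor $d$ of $2n$.
   Context: $D_{2n}=\langle a,b \mid a^n=b^2=(ba)^2=1\rangle$ is the dihedral group of order $2n$. For a finite group $G$ and a subgroup $H\le G$, a normalized right transversal (NRT) of $H$ in $G$ is a subset $S\subseteq G$ with $1\in S$ containing exactly one element of each right coset of $H$ in $G$; $\mathcal{T}(G,H)$ denotes the set of all NRTs of $H$ in $G$. An NRT $S$ carries the induced binary operation $\circ$ defined by $\{x\circ y\}=S\cap Hxy$ for $x,y\in S$, which makes $S$ a right loop with identity $1$. Two NRTs $S,T$ (possibly of different subgroups) are isomorphic, $S\cong T$, if there is a bijection $S\to T$ preserving the induced operations. For a divisor $d$ of $|G|$, the transiso graph $\Gamma_d(G)$ is the simple graph whose vertices are the subgroups of $G$ of order $d$, and in which two distinct vertices $H_1,H_2$ are adjacent if and only if there exist $S_i\in\mathcal{T}(G,H_i)$ $(i=1,2)$ with $S_1\cong S_2$. A graph is complete if any two distinct vertices are adjacent (graphs with at most one vertex are complete). *)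

(* Defs.v *)
From mathcomp Require Import all_boot all_fingroup.

Set Implicit Arguments.
Unset Strict Implicit.
Unset Printing Implicit Defensive.

Import GroupScope.

(* [NRT G H] is T(G, H); [rcosets H G] is the set of right cosets of H in G. *)
Definition NRT (gT : finGroupType) (G H : {group gT}) : {set {set gT}} :=
  [set S : {set gT} | (1 \in S) && is_transversal S (rcosets H G) G].

(* For x, y in S with S in T(G, H), the set S :&: H :* (x * y) is a singleton
   and [repr] returns its only element; outside S the value is irrelevant. *)
Definition nrt_op (gT : finGroupType) (H S : {set gT}) (x y : gT) : gT :=
  repr (S :&: H :* (x * y)).

(* (S1, o) and (S2, o) are isomorphic; only the values of f on S1 matter. *)
Definition nrt_isom (gT1 gT2 : finGroupType)
    (H1 S1 : {set gT1}) (H2 S2 : {set gT2}) : Prop :=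
  exists f : gT1 -> gT2,
    [/\ {in S1 &, injective f}, f @: S1 = S2
      & {in S1 &, {morph f : x y / nrt_op H1 S1 x y >-> nrt_op H2 S2 x y}}].

Definition transiso_vertices (gT : finGroupType) (G : {group gT}) (d : nat) :
    {set {group gT}} :=
  [set H in subgroups G | #|H| == d].

Definition transiso_adj (gT : finGroupType) (G : {group gT}) (d : nat)
    (H1 H2 : {group gT}) : Prop :=
  [/\ H1 \in transiso_vertices G d, H2 \in transiso_vertices G d, H1 != H2
    & exists S1 S2 : {set gT},
        [/\ S1 \in NRT G H1, S2 \in NRT G H2 & nrt_isom H1 S1 H2 S2]].

Definition complete_graph (T : finType) (V : {set T}) (adj : T -> T -> Prop) :
    Prop :=
  forall x y : T, x \in V -> y \in V -> x != y -> adj x y.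

(* The presentation <a, b | a^n = b^2 = (ba)^2 = 1>.  The library's 'D_m is
   specified only for m >= 4, whereas this covers every n >= 1. *)
Definition dihedral_group (gT : finGroupType) (G : {group gT}) (n : nat) :
    Prop :=
  G \isog Grp (a : b : (a ^+ n, b ^+ 2, (b * a) ^+ 2)).

(* Main.v *)
(** If an endomorphism phi of G pulls H2 back to H1 and |H1| = |H2|, then phi
    maps every NRT of H1 isomorphically onto an NRT of H2.  Let C be the
    rotation subgroup of G, and call the elements of G outside C reflections.
    The subgroups of C are determined by their orders.  Given two subgroups of
    the same order that both contain reflections, an automorphism fixing C
    pointwise and moving one reflection to another pulls one back to the other.
    If only H2 contains reflections, then |H1| = 2 |H2 :&: C|, and an
    endomorphism squaring the rotations pulls H2 back to H1, provided that it
    sends some reflection to r * a with r a reflection in H2 and a a generator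
    of C: since |C| is even, a is not a square times an element of H2. *)
Require Import Defs.
From mathcomp Require Import all_boot all_fingroup.
From mathcomp Require Import cyclic.

Set Implicit Arguments.
Unset Strict Implicit.
Unset Printing Implicit Defensive.

Import GroupScope.

(** * Normalized right transversals and their images under endomorphisms *)

Section Transversals.

Variables (gT : finGroupType) (G : {group gT}).
Implicit Types (H : {group gT}) (S : {set gT}).

(** Distinct elements of [S] lie in distinct right cosets, so the count [#|S| = #|G : H|] forces
    every coset to be met. *)
Lemma NRT_intro H S :
    H \subset G -> 1 \in S -> S \subset G ->
    {in S &, forall x y, x * y^-1 \in H -> x = y} -> #|S| = #|G : H| ->
  S \in NRT G H.
Proof.
move=> sHG S1 sSG injS oS.
have injH: {in S &, injective (rcoset H)}.
  move=> x y xS yS eq_xy; apply: injS => //.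
  by rewrite -mem_rcoset -rcosetE -eq_xy rcosetE rcoset_refl.
have defP: rcoset H @: S = rcosets H G.
  by apply/eqP; rewrite eqEcard imsetS //= (card_in_imset injH) oS.
rewrite inE S1 /=; apply/and3P; split=> //; first exact: rcosets_partition.
apply/forall_inP=> _ /[!(inE, =^~ defP)] /imsetP[x xS ->].
apply/cards1P; exists x; apply/setP=> y; rewrite !inE rcosetE mem_rcoset.
apply/andP/eqP=> [[yS xyH] | ->]; first exact: injS.
by rewrite mulgV group1.
Qed.

Lemma NRT_exists H : H \subset G -> exists S, S \in NRT G H.
Proof.
move=> sHG; exists (repr @: rcosets H G); apply: NRT_intro => //.
(* [repr] of a group is [1], so the coset [H] itself contributes the identity. *)
- apply/imsetP; exists (H :* 1); last by rewrite mulg1 repr_group.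
  by apply/rcosetsP; exists 1.
- apply/subsetP=> _ /imsetP[_ /rcosetsP[x xG ->] ->].
  have := mem_repr_rcoset H x; apply: (subsetP _).
  by rewrite mul_subG ?sub1set.
- move=> _ _ /imsetP[_ /rcosetsP[x xG ->] ->] /imsetP[_ /rcosetsP[y yG ->] ->].
  rewrite -mem_rcoset rcoset_repr => /rcoset_eqP.
  by rewrite rcoset_repr => ->.
rewrite card_in_imset // => _ _ /rcosetsP[x xG ->] /rcosetsP[y yG ->] eq_xy.
by rewrite -(rcoset_repr H x) eq_xy rcoset_repr.
Qed.

Lemma NRT_sub H S : S \in NRT G H -> S \subset G.
Proof. by rewrite inE => /andP[_ /transversal_sub]. Qed.

Lemma NRT_meet H S x :
  S \in NRT G H -> x \in G -> exists y, S :&: H :* x = [set y].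
Proof.
rewrite inE => /andP[_ /and3P[_ _ /forall_inP trS]] xG.
by apply/cards1P/trS/rcosetsP; exists x.
Qed.

Lemma NRT_inj H S :
  S \in NRT G H -> {in S &, forall x y, x * y^-1 \in H -> x = y}.
Proof.
move=> trS x y xS yS xyH.
have [z defz] := NRT_meet trS (subsetP (NRT_sub trS) y yS).
have /set1P->: x \in [set z] by rewrite -defz inE xS mem_rcoset.
by have /set1P->: y \in [set z] by rewrite -defz inE yS rcoset_refl.
Qed.

Lemma nrt_op_mem H S :
    S \in NRT G H ->
  {in S &, forall x y, nrt_op H S x y \in S :&: H :* (x * y)}.
Proof.
move=> trS x y xS yS; have sSG := subsetP (NRT_sub trS).
have [z defz] := NRT_meet trS (groupM (sSG x xS) (sSG y yS)).
by rewrite /nrt_op defz (mem_repr z) ?set11.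
Qed.

Lemma nrt_op_eq H S :
    S \in NRT G H ->
  {in S & &, forall x y z, z \in H :* (x * y) -> nrt_op H S x y = z}.
Proof.
move=> trS x y z xS yS zS zHxy; have sSG := subsetP (NRT_sub trS).
have [t deft] := NRT_meet trS (groupM (sSG x xS) (sSG y yS)).
have /set1P->: z \in [set t] by rewrite -deft inE zS.
by apply/set1P; rewrite -deft nrt_op_mem.
Qed.

Lemma nrt_isom_sym H1 H2 S1 S2 :
  S1 \in NRT G H1 -> nrt_isom H1 S1 H2 S2 -> nrt_isom H2 S2 H1 S1.
Proof.
move=> trS1 [f [injf <- fM]].
(* [f] is known to be injective only on [S1], so its inverse is picked by [repr] in each fibre
   inside [S1]. *)
pose g y := repr [set x in S1 | f x == y].
have fK: {in S1, cancel f g}.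
  move=> x xS; have: g (f x) \in [set z in S1 | f z == f x].
    by apply: (mem_repr x); rewrite inE xS eqxx.
  by rewrite inE => /andP[gS /eqP]; apply: injf.
exists g; split=> [_ _ /imsetP[x xS ->] /imsetP[y yS ->] | |].
- by rewrite !fK // => ->.
- by rewrite -imset_comp -[RHS]imset_id; apply: eq_in_imset.
move=> _ _ /imsetP[x xS ->] /imsetP[y yS ->]; rewrite -fM // !fK //.
by have /setIP[] := nrt_op_mem trS1 xS yS.
Qed.

(** [phi] may have a kernel: the pull-back condition alone sends distinct cosets of [H1] into
    distinct cosets of [H2], and equal orders give equal indices, so the image of [S1] meets every
    coset of [H2]. *)
Lemma nrt_isom_morph H1 H2 S1 (phi : gT -> gT) :
    H1 \subset G -> H2 \subset G -> #|H1| = #|H2| ->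
    {in G &, {morph phi : x y / x * y}} -> {in G, forall x, phi x \in G} ->
    {in G, forall x, (phi x \in H2) = (x \in H1)} -> S1 \in NRT G H1 ->
  phi @: S1 \in NRT G H2 /\ nrt_isom H1 S1 H2 (phi @: S1).
Proof.
move=> sH1G sH2G oH phiM phiG phiH trS.
have sSG := subsetP (NRT_sub trS).
pose f := Morphism phiM.
have phi_div x y: x \in G -> y \in G -> phi (x * y^-1) = phi x * (phi y)^-1.
  by move=> xG yG; rewrite -[phi]/(f : _ -> _) morphM ?morphV ?groupV.
have phiS x y: x \in S1 -> y \in S1 -> phi x * (phi y)^-1 \in H2 -> x = y.
  move=> xS yS; rewrite -phi_div ?sSG // phiH; first exact: (NRT_inj trS).
  by rewrite groupM ?groupV ?sSG.
have injphi: {in S1 &, injective phi}.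
  by move=> x y xS yS eq_xy; apply: phiS; rewrite // eq_xy mulgV group1.
have trS2: phi @: S1 \in NRT G H2.
  apply: NRT_intro => //.
  - apply/imsetP; exists 1; first by move: trS; rewrite inE => /andP[].
    by rewrite -[phi]/(f : _ -> _) morph1.
  - by apply/subsetP=> _ /imsetP[x xS ->]; rewrite phiG ?sSG.
  - move=> _ _ /imsetP[x xS ->] /imsetP[y yS ->] xyH.
    by rewrite (phiS x y).
  rewrite card_in_imset //; move: trS.
  rewrite inE => /andP[_ /card_transversal ->].
  by rewrite -[LHS]/#|G : H1| -!divgS // oH.
split=> //; exists phi; split=> // x y xS yS.
have /setIP[xyS xyH] := nrt_op_mem trS xS yS.
rewrite (nrt_op_eq trS2 _ _ (imset_f phi xyS)) ?imset_f //.
have [xG yG xyG]: [/\ x \in G, y \in G & nrt_op H1 S1 x y \in G].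
  by rewrite !sSG.
rewrite mem_rcoset -phiM // -phi_div ?groupM // phiH -?mem_rcoset //.
by rewrite mem_rcoset !groupM ?groupV ?groupM.
Qed.

End Transversals.

(** * Endomorphisms of a group with a cyclic rotation subgroup *)

Section DihedralEndomorphisms.

Variables (gT : finGroupType) (G C : {group gT}).
Hypotheses (cycC : cyclic C) (sCG : C \subset G).
Hypothesis mul_refl : {in G :\: C &, forall x y : gT, x * y \in C}.
Hypothesis refl_invol : {in G :\: C, forall x, x * x = 1}.
Implicit Type H : {group gT}.

Lemma rot_mul_refl x r : x \in C -> r \in G :\: C -> x * r \in G :\: C.
Proof.
by move=> xC /setDP[rG rC]; rewrite inE groupMl // rC groupM // (subsetP sCG).
Qed.

(** Since [x * r] is again a reflection, [x r x r = 1], while [r r = 1]. *)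
Lemma refl_mul_rot x r : x \in C -> r \in G :\: C -> r * x = x^-1 * r.
Proof.
move=> xC rR; have rr := refl_invol rR.
have := refl_invol (rot_mul_refl xC rR); rewrite !mulgA => xrxr.
by apply: (mulgI x); apply: (mulIg r); rewrite !mulgA xrxr mulgV mul1g rr.
Qed.

Lemma rot_commute x y : x \in C -> y \in C -> commute x y.
Proof. by move=> xC yC; apply: (centsP (cyclic_abelian cycC)). Qed.

(** A reflection [x] equals [(x * r1) * r1] with [x * r1] a rotation, so this is the map raising
    rotations to the power [k] and sending [r1] to [r2]. *)
Definition dihedral_endo k r1 r2 (x : gT) : gT :=
  if x \in C then x ^+ k else (x * r1) ^+ k * r2.

Lemma dihedral_endo_closed k r1 r2 x :
  r1 \in G :\: C -> r2 \in G :\: C -> x \in G -> dihedral_endo k r1 r2 x \in G.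
Proof.
move=> /setDP[r1G _] /setDP[r2G _] xG; rewrite /dihedral_endo.
by case: ifP => _; rewrite ?groupM ?groupX ?groupM.
Qed.

Lemma dihedral_endoM k r1 r2 :
    r1 \in G :\: C -> r2 \in G :\: C ->
  {in G &, {morph dihedral_endo k r1 r2 : x y / x * y}}.
Proof.
move=> r1R r2R x y xG yG; rewrite /dihedral_endo.
have [xC | xC] := boolP (x \in C); have [yC | yC] := boolP (y \in C).
- by rewrite groupM // expgMn //; apply: rot_commute.
- have yR: y \in G :\: C by rewrite inE yC.
  rewrite groupMl // (negPf yC) -mulgA expgMn ?mulgA //.
  by apply: rot_commute; rewrite ?mul_refl.
- have xR: x \in G :\: C by rewrite inE xC.
  rewrite groupMr // (negPf xC) -!mulgA.
  (* [r2] inverts [y ^+ k] and [r1] inverts [y], so both sides become [(x r1)^k y^-k r2]. *)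
  rewrite (refl_mul_rot (groupX k yC) r2R) -[y in LHS]invgK.
  rewrite -(refl_mul_rot (groupVr yC) r1R) !mulgA expgMn ?expgVn //.
  by apply: rot_commute; rewrite ?groupV ?mul_refl.
have [xR yR]: x \in G :\: C /\ y \in G :\: C by rewrite !inE xC yC.
have [xr1 yr1] := (mul_refl xR r1R, mul_refl yR r1R).
(* For two reflections the right side collapses to [((x r1) (y r1)^-1)^k], and
   [(x r1) (y r1)^-1 = x y]. *)
rewrite mul_refl // -!mulgA (mulgA r2) (refl_mul_rot (groupX k yr1) r2R).
rewrite -mulgA refl_invol // mulg1 -expgVn -expgMn; last first.
  by apply: rot_commute; rewrite ?groupV.
congr (_ ^+ k); apply: (mulIg (y * r1)); rewrite mulgKV -!mulgA; congr (x * _).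
by rewrite mulgA refl_invol ?mul1g.
Qed.

(** Right multiplication by [r] exchanges the elements of [H] inside and outside [C]. *)
Lemma card_refl_subgroup H r :
  H \subset G -> r \in H -> r \notin C -> #|H| = (#|H :&: C| * 2)%N.
Proof.
move=> sHG rH rC; rewrite -(cardsID C H) muln2 -addnn; congr (_ + _)%N.
have rR: r \in G :\: C by rewrite inE rC (subsetP sHG).
rewrite -(card_rcoset _ r); apply: eq_card => x.
have rV: r^-1 = r by apply: (mulgI r); rewrite mulgV refl_invol.
rewrite mem_rcoset rV !inE (groupMr _ rH) andbC; apply: andb_id2l => xH.
have [xC | xC] := boolP (x \in C); first by rewrite groupMl.
by rewrite mul_refl // inE xC (subsetP sHG).
Qed.

(** A subgroup of the cyclic group [C] contains the cycle of [x] exactly when its order is a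
    multiple of that of [x]. *)
Lemma mem_rot_subgroup H x :
  H \subset C -> x \in C -> (x \in H) = (x ^+ #|H| == 1).
Proof.
by move=> sHC xC; rewrite -order_dvdn (cardSg_cyclic cycC) ?cycle_subG.
Qed.

Lemma nrt_isom_refl_refl H1 H2 r1 r2 S1 :
    H1 \subset G -> H2 \subset G -> #|H1| = #|H2| ->
    r1 \in H1 :\: C -> r2 \in H2 :\: C -> S1 \in NRT G H1 ->
  exists S2 : {set gT}, S2 \in NRT G H2 /\ nrt_isom H1 S1 H2 S2.
Proof.
move=> sH1 sH2 oH /setDP[r1H r1C] /setDP[r2H r2C] trS1.
have r1R: r1 \in G :\: C by rewrite inE r1C (subsetP sH1).
have r2R: r2 \in G :\: C by rewrite inE r2C (subsetP sH2).
have eqK: (H1 :&: C)%G :=: (H2 :&: C)%G.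
  apply/eqP; rewrite (eq_subG_cyclic cycC) ?subsetIr //=.
  rewrite -(eqn_pmul2r (isT : 0 < 2)%N) -(card_refl_subgroup sH1 r1H r1C).
  by rewrite -(card_refl_subgroup sH2 r2H r2C) oH.
have eqHC x: x \in C -> (x \in H2) = (x \in H1).
  by move=> xC; move/setP/(_ x): eqK; rewrite !inE xC !andbT.
exists (dihedral_endo 1 r1 r2 @: S1); apply: nrt_isom_morph => //.
- exact: dihedral_endoM.
- by move=> x; apply: dihedral_endo_closed.
move=> x xG; rewrite /dihedral_endo !expg1; case: ifPn => xC; first exact: eqHC.
have xr1C: x * r1 \in C by rewrite mul_refl // inE xC.
by rewrite (groupMr _ r2H) eqHC // groupMr.
Qed.

Lemma nrt_isom_rot_refl H1 H2 r S1 :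
    H1 \subset C -> H2 \subset G -> #|H1| = #|H2| -> r \in H2 :\: C ->
    S1 \in NRT G H1 ->
  exists S2 : {set gT}, S2 \in NRT G H2 /\ nrt_isom H1 S1 H2 S2.
Proof.
move=> sH1 sH2 oH /setDP[rH rC] trS1.
have rR: r \in G :\: C by rewrite inE rC (subsetP sH2).
have oH2 := card_refl_subgroup sH2 rH rC.
have [a defC] := cyclicP cycC.
have aC: a \in C by rewrite defC cycle_id.
have raR: r * a \in G :\: C by rewrite refl_mul_rot ?rot_mul_refl ?groupV.
have oC: (#|H2 :&: C| * 2 %| #|C|)%N by rewrite -oH2 -oH cardSg.
(* [x ^+ #|H1|] is the power of [x ^+ 2] with exponent [#|H2 :&: C|]. *)
have sqr_mem x: x \in C -> (x ^+ 2 \in H2) = (x \in H1).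
  move=> xC; rewrite (mem_rot_subgroup sH1) // oH oH2 mulnC expgM.
  have x2C: x ^+ 2 \in C by rewrite groupX.
  by rewrite -(mem_rot_subgroup (subsetIr H2 C)) // inE x2C andbT.
exists (dihedral_endo 2 r (r * a) @: S1); apply: nrt_isom_morph => //.
- exact: subset_trans sCG.
- exact: dihedral_endoM.
- by move=> x; apply: dihedral_endo_closed.
move=> x xG; rewrite /dihedral_endo; case: ifPn => xC; first exact: sqr_mem.
rewrite (contraNF (subsetP sH1 x) xC); apply/negbTE/negP.
have xrC: x * r \in C by rewrite mul_refl // inE xC.
(* The image of [x] is [y^2 a^-1 r]; as [r] is in [H2], the rotation [y^2 a^-1] would lie in [H2]
   too. *)
set y := x * r in xrC *; rewrite refl_mul_rot // mulgA groupMr // => yaH.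
have yaC: y ^+ 2 * a^-1 \in C by rewrite groupM ?groupX ?groupV.
have: y ^+ 2 * a^-1 \in H2 :&: C by rewrite inE yaH.
rewrite (mem_rot_subgroup (subsetIr H2 C)) // -order_dvdn => dvd_ya.
have [q oCq] := dvdnP oC.
(* [#|H2 :&: C|] divides half of [#|C|], so the power [#|C| %/ 2] kills [y^2 a^-1]. It kills [y^2]
   as well, hence also [a], whose order is [#|C|]: a contradiction. *)
have: (y ^+ 2 * a^-1) ^+ (#|C| %/ 2) == 1.
  by rewrite -order_dvdn oCq mulnA mulnK // dvdn_mull.
have even_C: (2 %| #|C|)%N := dvdn_trans (dvdn_mull _ (dvdnn 2)) oC.
rewrite expgMn; last by apply: rot_commute; rewrite ?groupX ?groupV.
rewrite -expgM mulnC divnK // expg_cardG // mul1g expgVn eq_invg1.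
rewrite -order_dvdn orderE -defC => /dvdn_leq.
rewrite divn_gt0 // dvdn_leq // => /(_ isT).
by rewrite leqNgt ltn_Pdiv.
Qed.

Lemma nrt_isom_equal_order H1 H2 :
    H1 \subset G -> H2 \subset G -> #|H1| = #|H2| -> H1 != H2 ->
  exists S1 S2 : {set gT},
    [/\ S1 \in NRT G H1, S2 \in NRT G H2 & nrt_isom H1 S1 H2 S2].
Proof.
move=> sH1 sH2 oH neqH.
have [[S1 trS1] [S2 trS2]] := (NRT_exists sH1, NRT_exists sH2).
have [sH1C | /subsetPn[r1 r1H r1C]] := boolP (H1 \subset C);
  have [sH2C | /subsetPn[r2 r2H r2C]] := boolP (H2 \subset C).
- by rewrite -val_eqE /= (eq_subG_cyclic cycC) // oH eqxx in neqH.
- have r2HC: r2 \in H2 :\: C by rewrite inE r2C.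
  have [T2 [trT2 isoT]] := nrt_isom_rot_refl sH1C sH2 oH r2HC trS1.
  by exists S1, T2.
(* Only [H1] has reflections here, so the isomorphism is built from [H2] to [H1] and then
   inverted. *)
- have r1HC: r1 \in H1 :\: C by rewrite inE r1C.
  have [T1 [trT1 isoT]] := nrt_isom_rot_refl sH2C sH1 (esym oH) r1HC trS2.
  by exists T1, S2; split=> //; apply: nrt_isom_sym trS2 isoT.
have [r1HC r2HC]: r1 \in H1 :\: C /\ r2 \in H2 :\: C by rewrite !inE r1C r2C.
have [T2 [trT2 isoT]] := nrt_isom_refl_refl sH1 sH2 oH r1HC r2HC trS1.
by exists S1, T2.
Qed.

End DihedralEndomorphisms.

(** * The rotation subgroup from the presentation, and completeness *)

(* When b lies in <[a]>, G is cyclic and the last two clauses hold vacuously. *)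
Lemma dihedral_rotations (gT : finGroupType) (G : {group gT}) (n : nat) :
    dihedral_group G n ->
  exists C : {group gT},
    [/\ cyclic C, C \subset G, {in G :\: C &, forall x y : gT, x * y \in C}
      & {in G :\: C, forall x, x * x = 1}].
Proof.
move/isoGrp_hom/existsP=> [[a b] /= /eqP[defG _ b2 ba2]].
have aG: a \in G by rewrite -defG -cycle_subG joing_subl.
have bb: b * b = 1 by rewrite -expg2.
have bV: b^-1 = b by apply: (mulgI b); rewrite mulgV.
have ab: a ^ b = a^-1.
  rewrite conjgE bV; apply: (mulIg a); rewrite mulVg -!mulgA.
  by rewrite !mulgA -[RHS]ba2 expg2 !mulgA.
have nab: <[b]> \subset 'N(<[a]>).
  by rewrite cycle_subG inE -cycleJ ab cycleV.
have defAB: <[a]> * <[b]> = G by rewrite -norm_joinEr.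
(* Such an [x] is [c * b ^+ i] with [c] in [<[a]>]; as [b ^+ 2 = 1], an even [i] would put [x] in
   [<[a]>]. *)
have reflP x: x \in G :\: <[a]> -> exists2 c, c \in <[a]> & x = c * b.
  rewrite -defAB inE => /andP[xa /mulsgP[c _ ca /cycleP[i ->] defx]].
  exists c => //; move: xa; rewrite defx groupMl // (divn_eq i 2).
  rewrite expgD mulnC expgM b2 expg1n mul1g modn2.
  by case: (odd i); rewrite ?expg1 // group1.
have invb c: c \in <[a]> -> b * c = c^-1 * b.
  case/cycleP=> i ->; rewrite -expgVn -ab -conjXg conjgE bV -!mulgA bb.
  by rewrite mulg1.
exists <[a]>%G; split=> [||x y|x] /=.
- exact: cycle_cyclic.
- by rewrite cycle_subG.
- move=> /reflP[c ca ->] /reflP[e ea ->].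
  by rewrite -mulgA (mulgA b) invb // -mulgA bb mulg1 groupM ?groupV.
move=> /reflP[c ca ->].
by rewrite -mulgA (mulgA b) invb // -mulgA bb mulg1 mulgV.
Qed.

Theorem proposition2p9 (gT : finGroupType) (G : {group gT}) (n d : nat)
    (n_gt0 : (0 < n)%N) (dihG : dihedral_group G n) (dvd_d : (d %| 2 * n)%N) :
  complete_graph (transiso_vertices G d) (transiso_adj G d).
Proof.
have [C [cycC sCG mulR invR]] := dihedral_rotations dihG.
move=> H1 H2 vH1 vH2 neqH; split=> //; move: vH1 vH2.
rewrite !inE => /andP[sH1 /eqP oH1] /andP[sH2 /eqP oH2].
by apply: (nrt_isom_equal_order cycC) => //; rewrite oH1.
Qed.
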